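(* Let $p$ be a prime, let $G$ be an extraspecial $p$-group of order $p^{2n+1}$, and let $S\subseteq G\setminus\{1_G\}$ be an inverse-closed set that is closed under conjugation in $G$. Then $X=\mathrm{Cay}(G,S)$ is a Cayley graph of the elementary abelian $p$-group $\mathbb{Z}_p^{2n+1}$.
   Context: A $p$-group $G$ is extraspecial if its centre $Z(G)$ has order $p$ and $Z(G)=G'=\Phi(G)$, where $G'=[G,G]$ is the commutator subgroup and $\Phi(G)$ is the Frattini subgroup; then $|G|=p^{2n+1}$ for some $n\ge1$. $\mathrm{Cay}(G,S)$ is the graph with vertex set $G$ in which $g\sim h$ if and only if $hg^{-1}\in S$. A graph $X$ is a Cayley graph of a group $K$ if $X\cong\mathrm{Cay}(K,S')$ for some inverse-closed $S'\subseteq K$ not containing the identity. *)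

(* Defs.v *)
From mathcomp Require Import all_boot all_order all_algebra all_fingroup all_solvable.
Set Implicit Arguments.
Unset Strict Implicit.
Unset Printing Implicit Defensive.

Local Open Scope group_scope.

Definition inverse_closed (gT : finGroupType) (S : {set gT}) : Prop :=
  {in S, forall s, s^-1 \in S}.

Definition conj_closed (gT : finGroupType) (G : {group gT}) (S : {set gT}) : Prop :=
  {in S & G, forall s g, s ^ g \in S}.

(* A graph is given by its adjacency relation on a finite type of vertices;
   the vertices of Cay(G, S) are the elements of G, i.e. the type [subg G]. *)
Definition Cay (gT : finGroupType) (G : {group gT}) (S : {set gT}) : rel [subg G] :=
  fun g h => sgval h * (sgval g)^-1 \in S.
Arguments Cay {gT} G S.

Definition graph_iso (V W : finType) (e : rel V) (e' : rel W) : Prop :=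
  exists2 f : V -> W, bijective f & {mono f : x y / e x y >-> e' x y}.

Definition is_Cayley_graph_of (V : finType) (e : rel V)
    (rT : finGroupType) (K : {group rT}) : Prop :=
  exists S' : {set rT},
    [/\ S' \subset K, 1 \notin S', inverse_closed S' & graph_iso e (Cay K S')].

(* Main.v *)
Require Import Defs.
From mathcomp Require Import all_boot all_order all_algebra all_fingroup all_solvable all_character.
Set Implicit Arguments.
Unset Strict Implicit.
Unset Printing Implicit Defensive.
Local Open Scope group_scope.

(** In an extraspecial group every conjugacy class outside the centre Z is a
    full coset of Z, so S is the union of a subset of Z and of the preimage of
    a subset of G / Z. Hence Cay(G, S) is a lexicographic product of a Cayley
    graph of G / Z with a Cayley graph of Z, which is a Cayley graph of the
    elementary abelian group G / Z x Z. *)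

Lemma card_subg (gT : finGroupType) (G : {group gT}) : #|{: [subg G]}| = #|G|.
Proof. by rewrite (card_isog (isog_subg G)) cardsT. Qed.

Lemma is_Cayley_graph_of_isog (V : finType) (e : rel V)
    (aT rT : finGroupType) (K : {group aT}) (L : {group rT}) :
  K \isog L -> is_Cayley_graph_of e K -> is_Cayley_graph_of e L.
Proof.
case/isogP=> u injU defL [C [sCK nC1 CV [f [f' fK f'K] fe]]].
have memU x : (x \in K) -> (u x \in u @* C) = (x \in C).
  by move=> Kx; rewrite -sub1set -morphim_set1 // injmSK ?sub1set.
have uL (x : [subg K]) : u (sgval x) \in L.
  by rewrite -defL mem_morphim ?subgP.
exists (u @* C); split.
- by rewrite -defL morphimS.
- by rewrite -(morph1 u) memU ?group1.
- move=> _ /morphimP[x Kx Cx ->].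
  by rewrite -morphV // memU ?groupV // CV.
exists (fun v => subg L (u (sgval (f v)))).
  have injF : injective (fun v => subg L (u (sgval (f v)))).
    move=> v w /(congr1 sgval); rewrite !subgK // => /(injmP injU).
    by move=> /(_ (subgP _) (subgP _)) /subg_inj /(can_inj fK).
  apply: (inj_card_bij injF).
  rewrite (bij_eq_card (Bijective fK f'K)) !card_subg.
  by rewrite -(card_injm injU (subxx K)) defL.
move=> v w; rewrite -fe /Cay !subgK //.
by rewrite -morphV ?subgP // -morphM ?groupV ?subgP // memU ?groupM ?groupV ?subgP.
Qed.

Section LexicographicCayley.

Variables (gT : finGroupType) (G N : {group gT}) (S : {set gT}).
Hypothesis nNG : N <| G.

(** The coordinate of [x] along [N], measured from the chosen representative of its coset. It need
    not be multiplicative, but within one coset it determines [x]. *)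
Let tail (x : gT) := x * (repr (coset N x))^-1.

Let tail_mem x : x \in G -> tail x \in N.
Proof.
move=> Gx; have nNx := subsetP (normal_norm nNG) x Gx.
by rewrite -mem_rcoset; apply/rcoset_kercosetP; rewrite ?repr_coset_norm ?coset_reprK.
Qed.

(** The bijection [x |-> (coset N x, tail x)] need not be a homomorphism: it only has to send
    adjacency in [Cay G S] to adjacency for the set [C] below. *)
Lemma Cayley_quotient_setX (sSG : S \subset G :\ 1) (SV : inverse_closed S)
    (SN : {in S :\: N & N, forall s z, s * z \in S}) :
  is_Cayley_graph_of (Cay G S) (setX (G / N) N)%G.
Proof.
have nG x : x \in G -> x \in 'N(N) := subsetP (normal_norm nNG) x.
(* Lexicographic rule: a nontrivial first coordinate decides alone; otherwise the second one is
   tested against [S]. *)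
pose C := [set u in setX (G / N) N |
  if u.1 == 1 then u.2 \in S else u.1 \in S / N].
(* By [SN], the part of [S] outside [N] is a union of cosets, so membership there can be read off in
   the quotient. *)
have memS x : x \in G -> x \notin N -> (coset N x \in S / N) = (x \in S).
  move=> Gx nNx; apply/idP/idP=> [|Sx]; last by rewrite mem_morphim ?nG.
  case/morphimP=> s nNs Ss /esym/rcoset_kercosetP.
  move=> /(_ nNs (nG _ Gx)); rewrite mem_rcoset => Nsx.
  have nNs' : s \notin N.
    by apply: contra nNx => Ns; move: Nsx; rewrite groupMl // groupV.
  (* [SN] multiplies on the right, whereas [Nsx] says that [s * x^-1] lies in [N]; conjugation by
     [x^-1], which normalises [N], links the two. *)
  have -> : x = s * (x^-1 * s)^-1 by rewrite invMg invgK mulKVg.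
  apply: SN; rewrite ?inE ?nNs' // groupV.
  by rewrite -(memJ_norm _ (groupVr (nG _ Gx))) conjgE invgK -mulgA mulKVg.
exists C; split.
- by apply/subsetP=> u; rewrite inE => /andP[].
- by rewrite inE /= eqxx; apply/negP=> /andP[_ /(subsetP sSG)]; rewrite !inE eqxx.
- move=> [c z]; rewrite !inE /= => /andP[/andP[Gc Nz]].
  rewrite !groupV Gc Nz invg_eq1 /=.
  case: ifP => [_ /SV //|_ /morphimP[s nNs Ss ->]].
  by rewrite -morphV // mem_morphim ?groupV ?SV.
pose f (x : [subg G]) :=
  subg (setX_group (G / N) N) (coset N (sgval x), tail (sgval x)).
have fE x : sgval (f x) = (coset N (sgval x), tail (sgval x)).
  by apply: subgK; rewrite inE /= mem_quotient ?tail_mem ?subgP.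
have injF : injective f.
  move=> x y /(congr1 sgval); rewrite !fE => -[cxy].
  by rewrite /tail cxy => /mulIg /subg_inj.
exists f.
  apply: (inj_card_bij injF); rewrite !card_subg cardsX.
  by rewrite card_quotient ?normal_norm // mulnC Lagrange ?normal_sub.
move=> x y; rewrite /Cay !fE; have [Gx Gy] := (subgP x, subgP y).
move: (sgval x) (sgval y) Gx Gy => {}x {}y Gx Gy.
rewrite inE /= inE /= groupM ?groupV ?mem_quotient //=.
rewrite (groupM (tail_mem Gy)) ?groupV ?tail_mem //=.
rewrite -morphV ?nG // -morphM ?groupV ?nG //=.
have Gyx : y * x^-1 \in G by rewrite groupM ?groupV.
(* If [x] and [y] share a coset, they share its representative, which cancels in
   [tail y * (tail x)^-1] and leaves [y * x^-1]. *)
case: ifPn => [/eqP/(coset_idr (nG _ Gyx)) Nyx | nNyx].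
  have /rcoset_kercosetP : y \in N :* x by rewrite mem_rcoset.
  by move=> /(_ (nG _ Gy) (nG _ Gx)) cyx; rewrite /tail cyx invMg invgK mulgA mulgKV.
by rewrite memS //; apply: contra nNyx => /coset_id ->.
Qed.

End LexicographicCayley.

(** Each conjugate is [x * [x, g]] with [[x, g]] in [G' = 'Z(G)], which gives one inclusion. The
    sizes agree: the centraliser of [x] is maximal, so the class has [p] elements, as does the
    centre. *)
Lemma extraspecial_class (p : nat) (gT : finGroupType) (G : {group gT}) (x : gT) :
  p.-group G -> extraspecial G -> x \in G -> x \notin 'Z(G) ->
  x ^: G = x *: 'Z(G).
Proof.
move=> pG esG Gx nZx; have [[_ defG'] _] := esG.
apply/eqP; rewrite eqEcard; apply/andP; split.
  apply/subsetP=> _ /imsetP[g Gg ->].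
  by rewrite mem_lcoset -defG' mem_commg.
rewrite card_lcoset -index_cent1 (card_center_extraspecial pG esG).
by rewrite (p_maximal_index pG (cent1_extraspecial_maximal esG Gx nZx)).
Qed.

Theorem lemma5p15 (p n : nat) (gT : finGroupType) (G : {group gT}) (S : {set gT})
    (p_pr : prime p) (pG : p.-group G) (esG : extraspecial G)
    (oG : #|G| = (p ^ (2 * n + 1))%N)
    (sSG : S \subset G :\ 1) (SV : inverse_closed S) (SJ : conj_closed G S) :
  is_Cayley_graph_of (Cay G S) [set: 'rV['F_p]_(2 * n + 1)]%G.
Proof.
have [[defPhi _] _] := esG.
have nZG : 'Z(G) <| G := center_normal G.
apply: (is_Cayley_graph_of_isog (K := (setX (G / 'Z(G)) 'Z(G))%G)); last first.
  apply: Cayley_quotient_setX => // s z /setDP[Ss nZs] Zz.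
  have Gs : s \in G by case/setD1P: (subsetP sSG s Ss).
  have : s * z \in s ^: G.
    by rewrite (extraspecial_class pG) // mem_lcoset mulKg.
  by case/imsetP=> g Gg ->; apply: SJ.
(* The quotient is elementary abelian because ['Z(G)] is the Frattini subgroup, and the centre is so
   because [G] is special. *)
have abX : p.-abelem (setX (G / 'Z(G)) 'Z(G)).
  rewrite (dprod_abelem p (setX_dprod _ _)).
  rewrite -(isog_abelem (isog_setX1 _ _)) -(isog_abelem (isog_set1X _ _)).
  rewrite (center_special_abelem pG) ?andbT; last by case: esG.
  by rewrite -defPhi Phi_quotient_abelem.
(* Elementary abelian [p]-groups are isomorphic once their orders agree; here both orders equal that
   of [G]. *)
rewrite (isog_abelem_card _ abX) mx_Fp_abelem //=.
rewrite cardsT card_mx card_Fp // mul1n -oG cardsX card_quotient ?normal_norm //.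
by rewrite mulnC Lagrange ?normal_sub.
Qed.
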